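(* Let $k\ge0$ and $n\ge k+2$ be integers, let $y\in\mathbb{R}^n$ and $\lambda\ge0$. For inputs $x_1<\cdots<x_n$, consider the functions $h_1,\ldots,h_n$ defined by $$h_1(x)=1,\ h_2(x)=x,\ \ldots,\ h_{k+1}(x)=x^k,\qquad h_{k+1+j}(x)=\prod_{\ell=1}^k(x-x_{j+\ell})\cdot 1\{x\ge x_{j+k}\},\quad j=1,\ldots,n-k-1,$$ and define the linear subspace of functions $$\mathcal{H}_k=\operatorname{span}\{h_1,\ldots,h_n\}=\Bigl\{\sum_{j=1}^n\alpha_jh_j:\alpha_1,\ldots,\alpha_n\in\mathbb{R}\Bigr\}.$$ If the inputs are evenly spaced, $x_i=i/n$, $i=1,\ldots,n$, then the continuous-time minimization problem $$\hat f=\operatorname{argmin}_{f\in\mathcal{H}_k}\ \tfrac12\sum_{i=1}^n(y_i-f(x_i))^2+\lambda\cdot\mathrm{TV}(f^{(k)})$$ (where $f^{(k)}$ is understood to mean the $k$th weak derivative of $f$) is equivalent to the $k$th order trend filtering problem $$\hat\beta=\operatorname{argmin}_{\beta\in\mathbb{R}^n}\ \tfrac12\|y-\beta\|_2^2+\frac{n^k}{k!}\,\lambda\,\|D^{(k+1)}\beta\|_1,$$ that is, their solutions match at the input points: $\hat\beta_i=\hat f(x_i)$ for $i=1,\ldots,n$.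
   Context: The discrete difference operators are defined by $D^{(1)}$ with $(D^{(1)}\beta)_i=\beta_{i+1}-\beta_i$ (of size $(m-1)\times m$ when acting on $\mathbb{R}^m$), and recursively $D^{(k+1)}=D^{(1)}D^{(k)}\in\mathbb{R}^{(n-k-1)\times n}$, where here $D^{(1)}$ has size $(n-k-1)\times(n-k)$. $\mathrm{TV}(g)=\sup\{\sum_{i=1}^{p-1}|g(z_{i+1})-g(z_i)| : z_1<\cdots<z_p \text{ a partition of }[0,1]\}$. An empty product (case $k=0$) equals $1$, and $f^{(0)}=f$.
   Formalization: Penalty taken as (λ/k!)·TV(f^(k)) (as printed off by k! for k≥2); indicator 1{x>x_{j+k}} (differs only for k=0, where ≥ forces f(x_{n-1})=f(x_n)); f^(k) is the weak derivative on (0,1) minus the inputs (for k≥2 none exists on all of (0,1)). *)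

(* Defs.v *)
From mathcomp Require Import all_boot all_order all_algebra.
From mathcomp Require Import all_classical all_reals all_analysis.

Set Implicit Arguments.
Unset Strict Implicit.
Unset Printing Implicit Defensive.

Import Order.TTheory GRing.Theory Num.Theory.
Import numFieldNormedType.Exports.

Local Open Scope classical_set_scope.
Local Open Scope ring_scope.

Definition argmin (T : Type) (d : Order.disp_t) (O : porderType d)
    (S : set T) (F : T -> O) : set T :=
  [set a | S a /\ forall b, S b -> (F a <= F b)%O].

Section DiscreteDifferences.
Variable R : realType.

Definition diff1_mx (m : nat) : 'M[R]_(m.-1, m) :=
  \matrix_(i, j) ((j == i.+1 :> nat)%:R - (j == i :> nat)%:R).

(* [iter k predn n] is [n - k]; this form makes the recursion type-check
   without casts. *)
Fixpoint diff_mx (n k : nat) : 'M[R]_(iter k predn n, n) :=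
  if k is k'.+1 then diff1_mx (iter k' predn n) *m diff_mx n k' else 1%:M.

Definition l1norm (m : nat) (v : 'cV[R]_m) : R := \sum_i `|v i 0|.

Definition sql2norm (m : nat) (v : 'cV[R]_m) : R := \sum_i v i 0 ^+ 2.

Definition trend_obj (n k : nat) (y : 'cV[R]_n) (lam : R) (b : 'cV[R]_n) : R :=
  2^-1 * sql2norm (y - b)
  + n%:R ^+ k / k`!%:R * lam * l1norm (diff_mx n k.+1 *m b).

End DiscreteDifferences.

Section FunctionSpace.
Variable R : realType.

(* Indices are 1-based: the inputs are [x 1, ..., x n] and the functions are
   [hfun k x 1, ..., hfun k x n]; an index [k + 1 + j] with [j >= 1] gives the
   [j]-th truncated product.
   The indicator is that of [t > x (j + k)].  For [k > 0] it may be replaced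
   by [t >= x (j + k)], the product being zero at [x (j + k)] (lemma [hfun_ge]).
   For [k = 0] the strict inequality matters: with [t >= x j] every function
   of the span would take the same value at [x (n - 1)] and at [x n]. *)
Definition hfun (k : nat) (x : nat -> R) (i : nat) (t : R) : R :=
  if (i <= k.+1)%N then t ^+ i.-1 else
  let j := (i - k.+1)%N in
  (\prod_(1 <= l < k.+1) (t - x (j + l)%N)) * (x (j + k)%N < t)%R%:R.

Lemma hfun_ge (k : nat) (x : nat -> R) (j : nat) (t : R) :
  (0 < k)%N -> (0 < j)%N ->
  hfun k x (k.+1 + j) t =
  (\prod_(1 <= l < k.+1) (t - x (j + l)%N)) * (x (j + k)%N <= t)%R%:R.
Proof.
move=> k0 j0; rewrite /hfun -[leqRHS]addn0 leq_add2l leqNgt j0 /= addKn.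
rewrite le_eqVlt; have [xt|//] := eqVneq (x (j + k)%N) t.
by rewrite -xt big_nat_recr //= subrr mulr0 !mul0r.
Qed.

Definition Hspace (n k : nat) (x : nat -> R) : set (R -> R) :=
  [set f | exists a : 'I_n -> R,
     f = fun t => \sum_(j < n) a j * hfun k x j.+1 t].

Definition test_function (U : set R) (phi : R -> R) : Prop :=
  [/\ forall m t, derivable (derive1n m phi) t 1,
      compact (closure [set t | phi t != 0]) &
      closure [set t | phi t != 0] `<=` U].

Definition is_weak_derivative (U : set R) (k : nat) (f g : R -> R) : Prop :=
  [/\ locally_integrable U f, locally_integrable U g &
      forall phi, test_function U phi ->
        \int[lebesgue_measure]_(t in U) (f t * derive1n k phi t) =
        (-1) ^+ k * \int[lebesgue_measure]_(t in U) (g t * phi t)].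

(* All versions of [f^(k)]: a weak derivative is determined only up to a null
   set, whereas [f^(0)] is [f] itself. *)
Definition derivative_versions (U : set R) (k : nat) (f : R -> R) :
    set (R -> R) :=
  if k is 0 then [set f] else [set g | is_weak_derivative U k f g].

(* The total variation over [0, 1] of an almost-everywhere class is the
   smallest one among its representatives. *)
Definition TV_derivative (U : set R) (k : nat) (f : R -> R) : \bar R :=
  ereal_inf [set total_variation 0 1 g | g in derivative_versions U k f].

(* For [k >= 2] the members of [Hspace] have corners at the knots, hence no
   [k]-th weak derivative on the whole of (0, 1) (the distributional one has
   singular parts at the knots).  The derivative is therefore taken on (0, 1)
   deprived of the finitely many inputs, which determines it almost
   everywhere on [0, 1]. *)
Definition off_inputs (n : nat) (x : nat -> R) : set R :=
  [set t | 0 < t < 1 /\ forall i, (1 <= i <= n)%N -> t != x i].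

(* The truncated products have leading coefficient 1, so that a coefficient
   [a] of one of them contributes [k! * |a|] to the total variation, but
   [|a|] to the penalty of [trend_obj] at evenly spaced inputs: the parameter
   [lam / k!] here corresponds to [lam] there. *)
Definition spline_obj (n k : nat) (x : nat -> R) (y : 'cV[R]_n) (lam : R)
    (f : R -> R) : \bar R :=
  ((2^-1 * \sum_(i < n) (y i 0 - f (x i.+1)) ^+ 2)%:E
   + lam%:E * TV_derivative (off_inputs n x) k f)%E.

End FunctionSpace.

(* Main.v *)
Require Import Defs.
From mathcomp Require Import all_boot all_order all_algebra.
From mathcomp Require Import all_classical all_reals all_analysis.
From mathcomp Require Import measurable_realfun ring lra zify.
Set Implicit Arguments.
Unset Strict Implicit.
Unset Printing Implicit Defensive.
Import Order.TTheory GRing.Theory Num.Theory.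
Import numFieldNormedType.Exports.
Local Open Scope classical_set_scope.
Local Open Scope ring_scope.

(** Write a member of the spline space as [f = \sum_j a j * h_j], with [j] counted
    from 0, so that the truncated products are the [h_j] with [k < j].
    Evaluation at the grid points [i/n] is a bijection between the spline space
    and the vectors of values ([spline_mx_unit]), and it carries one objective
    function to the other ([spline_objE]).  The common objective on vectors is
    continuous, coercive and strongly convex, so it has exactly one minimizer
    ([penalized_ls_argmin]), and this minimizer is the vector of values of the
    unique minimizing spline.

    The fidelity terms are visibly the same, and each of the penalties is a
    multiple of [\sum_(k < j) |a j|].

    On the discrete side, a difference of order [k+1] annihilates the values of a
    polynomial of degree at most [k], and applied to the values of a truncated
    product it is nonzero only at the window that ends just after the truncation
    knot; there it is equal to [k!/n^k] ([iter_fdiff_hfun]).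

    On the continuous side, the [k]-th derivative of [f] off the knots is the step
    function that jumps by [k! * a j] at the knot of [h_j].  It is a weak
    derivative because test functions vanish with all their derivatives at the
    deleted knots, so that integration by parts from a knot to 1 leaves no
    boundary term ([is_weak_derivative_trunc]); its variation is at most the sum
    of the absolute jumps.  Conversely an arbitrary version of the derivative has
    the same integrals as the step function against bumps supported between two
    knots, so in each gap it takes values almost as large, and values almost as
    small, as the level of the step function ([weak_derivative_ge],
    [weak_derivative_le]).  This is enough to find points along which its
    variation is almost the sum of the jumps ([total_variation_ge_steps]).
    For [k = 0] the spline is itself this step function and the only version.
    Hence the smallest variation of a version is [k! * \sum_(k < j) |a j|]
    ([TV_derivative_spline]). *)

(** * Forward differences *)

Section FiniteDifferences.
Variable R : realType.
Implicit Types (u : nat -> R) (p : {poly R}).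

Definition fdiff u : nat -> R := fun i => u i.+1 - u i.

Lemma sumr_delta n (F : 'I_n -> R) i (im : (i < n)%N) :
  \sum_j F j * (j == i :> nat)%:R = F (Ordinal im).
Proof.
rewrite (bigD1 (Ordinal im)) //= eqxx mulr1 big1 ?addr0// => j ji.
by rewrite (_ : _ == _ = false) ?mulr0//; exact/negbTE.
Qed.

(** The rows of the difference matrix only look at indices below [n], so the
    matrix may be replaced by an operator on infinite sequences, which needs
    no bookkeeping of dimensions. *)
Lemma mul_diff_mx_col n k u (i : 'I_(iter k predn n)) :
  (diff_mx R n k *m \col_j u j) i 0 = iter k fdiff u i.
Proof.
suff -> : diff_mx R n k *m \col_j u j = \col_j iter k fdiff u j by rewrite mxE.
elim: k {i} => [|k IH] /=; first by rewrite mul1mx.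
rewrite -mulmxA IH; move: (iter k fdiff u) (iter k predn n) => v m.
apply/colP => i; rewrite !mxE.
have im : (i.+1 < m)%N by have := ltn_ord i; lia.
under eq_bigr => j _ do rewrite !mxE mulrC mulrBr.
by rewrite sumrB (sumr_delta v im) (sumr_delta v (ltnW im)).
Qed.

Lemma iter_fdiff_shift m u r :
  iter m fdiff u r = iter m fdiff (fun i => u (r + i)%N) 0%N.
Proof.
rewrite -[in LHS](addn0 r); elim: m 0%N => //= m IH i.
by rewrite /fdiff -addnS !IH.
Qed.

(** In an [m]-th difference the last term has coefficient 1, and it is the only
    one that survives here. *)
Lemma iter_fdiff_last m u r : (forall l, (l < m)%N -> u (r + l)%N = 0) ->
  iter m fdiff u r = u (r + m)%N.
Proof.
elim: m r => [|m IH] r u0; first by rewrite addn0.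
rewrite iterS {1}/fdiff (IH r.+1) => [|l lm]; last by rewrite addSnnS u0.
by rewrite IH => [|l lm]; rewrite u0 ?subr0 ?addSnnS// ltnW.
Qed.

(** A shift of the variable keeps the leading coefficient. *)
Lemma size_poly_shiftB p (s : R) :
  (size (p \Po ('X + s%:P) - p)%R <= (size p).-1)%N.
Proof.
have [->|p0] := eqVneq p 0; first by rewrite comp_poly0 subr0 size_poly0.
have sc : size (p \Po ('X + s%:P)) = size p by rewrite size_comp_poly2// size_XaddC.
apply/leq_sizeP => i; rewrite leq_eqVlt => /orP[/eqP <-|i1]; rewrite coefB.
  have := lead_coef_comp p (q := 'X + s%:P); rewrite size_XaddC => /(_ isT).
  by rewrite lead_coefXaddC expr1n mulr1 !lead_coefE sc => ->; rewrite subrr.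
by rewrite !nth_default ?sc ?subrr//; case: (size p) i1.
Qed.

Lemma iter_fdiff_poly m p (c s : R) i : (size p <= m)%N ->
  iter m fdiff (fun j => p.[c + j%:R * s]) i = 0.
Proof.
elim: m p => [|m IH] p pm.
  by move: pm; rewrite size_poly_leq0 => /eqP -> /=; rewrite horner0.
rewrite iterSr (_ : fdiff _ = fun j => (p \Po ('X + s%:P) - p).[c + j%:R * s]).
  by rewrite IH// (leq_trans (size_poly_shiftB _ _))//; lia.
apply/funext => j; rewrite /fdiff hornerD hornerN horner_comp hornerD hornerX.
by rewrite hornerC -natr1 mulrDl mul1r addrA.
Qed.

End FiniteDifferences.

(** * The truncated products and their values on the even grid *)

Section TruncatedPowerBasis.
Variables (R : realType) (k : nat) (x : nat -> R).

(** The polynomial factor of the basis function of 0-based index [j]; the other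
    factor is an indicator when [j > k], and the truncation is then at [x j]. *)
Definition basis_poly j : {poly R} :=
  if (j <= k)%N then 'X^j else \prod_(1 <= l < k.+1) ('X - (x (j - k + l)%N)%:P).

Lemma hfunE j t :
  hfun k x j.+1 t = (basis_poly j).[t] * ((j <= k)%N || (x j < t))%:R.
Proof.
rewrite /hfun /basis_poly ltnS; have [jk|jk] := leqP j k => /=.
  by rewrite hornerXn mulr1.
rewrite horner_prod subSS subnK ?(ltnW jk)//; congr (_ * _).
by apply: eq_bigr => l _; rewrite !hornerE.
Qed.

Lemma size_basis_poly j : (size (basis_poly j) <= k.+1)%N.
Proof.
rewrite /basis_poly; have [jk|jk] := leqP j k; first by rewrite size_polyXn.
by rewrite size_prod_XsubC size_iota; lia.
Qed.

Lemma coef_basis_poly j : (basis_poly j)`_k = (k <= j)%N%:R.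
Proof.
rewrite /basis_poly; have [jk|jk] := leqP j k.
  by rewrite coefXn; congr (_ %:R); lia.
rewrite (ltnW jk).
have := monic_prod_XsubC (index_iota 1 k.+1) predT (fun l => x (j - k + l)%N).
by rewrite monicE lead_coefE size_prod_XsubC size_iota subn1 => /eqP.
Qed.

(** For [j >= k] the factor is monic of degree [k]. *)
Lemma derivn_basis_poly j t : ((basis_poly j)^`(k)).[t] = k`!%:R * (k <= j)%N%:R.
Proof.
rewrite (_ : _^`(k) = (((k <= j)%N%:R : R) *+ k`!)%:P).
  by rewrite hornerC mulr_natl.
apply/polyP => i; rewrite coef_derivn coefC; case: i => [|i] /=.
  by rewrite addn0 coef_basis_poly ffactnn.
by rewrite nth_default ?mul0rn// (leq_trans (size_basis_poly _))//; lia.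
Qed.

End TruncatedPowerBasis.

Section EvenGrid.
Variables (R : realType) (n k : nat).
Hypothesis n0 : (0 < n)%N.

Definition grid (i : nat) : R := i%:R / n%:R.

Lemma grid_lt i j : (grid i < grid j) = (i < j)%N.
Proof. by rewrite /grid ltr_pM2r ?invr_gt0 ?ltr0n// ltr_nat. Qed.

(** The values are zero up to the truncation knot, and on the last [k] of these
    points already the polynomial factor is zero.  A window of [k+2] points that
    stops at the knot gives 0; so does a window that starts among those [k]
    points or later, because it sees a polynomial of degree at most [k].  The
    only other window ends at the first point after the knot, where the product
    of the distances [l/n] to the [k] preceding points is [k!/n^k]. *)
Lemma iter_fdiff_hfun j r :
  iter k.+1 (@fdiff R) (fun i => hfun k grid j.+1 (grid i.+1)) r =
  k`!%:R / n%:R ^+ k * (j == (r + k.+1)%N)%:R.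
Proof.
set u := fun i => _.
have uE i : u i = (basis_poly k grid j).[grid 1 + i%:R * n%:R^-1] * (j <= maxn k i)%N%:R.
  rewrite /u hfunE grid_lt ltnS leq_max; congr (_.[_] * _).
  by rewrite /grid -mulrDl -natrD add1n.
have [jk|kj] := leqP j k.
  rewrite (_ : j == _ = false); last by apply/negP; lia.
  rewrite mulr0 (_ : u = fun i => (basis_poly k grid j).[grid 1 + i%:R * n%:R^-1]).
    by rewrite iter_fdiff_poly// size_basis_poly.
  by apply/funext => i; rewrite uE (_ : (j <= _)%N) ?mulr1//; lia.
have u0 i : (i < j)%N -> u i = 0.
  by move=> ij; rewrite uE (_ : (_ <= _)%N = false) ?mulr0//; apply/negP; lia.
have [jr|rj|jE] := ltngtP j (r + k.+1).
- rewrite mulr0 iter_fdiff_shift.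
  rewrite (_ : (fun i => _) =
    fun i => (basis_poly k grid j).[grid r.+1 + i%:R * n%:R^-1]).
    by rewrite iter_fdiff_poly// size_basis_poly.
  apply/funext => i; rewrite uE.
  (* an index before the knot lies on one of the zeros of the product *)
  have -> : grid 1 + (r + i)%:R * n%:R^-1 = grid r.+1 + i%:R * n%:R^-1.
    by rewrite /grid -!mulrDl -!natrD add1n addSn.
  have [ji|ij] := leqP j (r + i); first by rewrite (_ : (_ <= _)%N) ?mulr1//; lia.
  suff -> : (basis_poly k grid j).[grid r.+1 + i%:R / n%:R] = 0 by rewrite mul0r.
  rewrite /basis_poly leqNgt kj /= horner_prod; apply/eqP; rewrite prodf_seq_eq0.
  apply/hasP; exists (r + i + k - j).+1; first by rewrite mem_index_iota; lia.
  rewrite /= !hornerE subr_eq0 /grid -mulrDl -natrD; apply/eqP.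
  by congr (_%:R / _); lia.
- by rewrite mulr0 iter_fdiff_last ?u0// => l lk; rewrite u0//; lia.
rewrite mulr1 iter_fdiff_last; last by move=> l lk; rewrite u0//; lia.
rewrite -jE uE (_ : (_ <= _)%N) ?mulr1; last by lia.
rewrite /basis_poly leqNgt kj /=.
rewrite horner_prod.
transitivity (\prod_(1 <= l < k.+1) ((k.+1 - l)%N%:R / n%:R : R)).
  apply: eq_big_nat => l /andP[l1 lk]; rewrite !hornerE.
  rewrite /grid -mulrDl -natrD add1n -mulrBl -natrB; last by lia.
  by congr (_%:R / _); lia.
rewrite big_split /= prodr_const_nat subn1 exprVn; congr (_ / _).
rewrite -natr_prod; congr _%:R; rewrite big_add1 /= fact_prod big_add1 /=.
by rewrite big_nat_rev /=; apply: eq_big_nat => l lk; lia.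
Qed.


Definition spline_mx : 'M[R]_n :=
  \matrix_(i, j) hfun k grid j.+1 (grid i.+1).

Lemma iter_fdiff_sum m (I : finType) (c : I -> R) (u : I -> nat -> R) r :
  iter m (@fdiff R) (fun i => \sum_j c j * u j i) r =
  \sum_j c j * iter m (@fdiff R) (u j) r.
Proof.
elim: m r => //= m IH r; rewrite {1}/fdiff !IH -sumrB.
by apply: eq_bigr => j _; rewrite -mulrBr.
Qed.

Lemma diff_spline_mx (c : 'cV[R]_n) (i : 'I_(iter k.+1 predn n)) :
  (diff_mx R n k.+1 *m (spline_mx *m c)) i 0 =
  k`!%:R / n%:R ^+ k * \sum_j c j 0 * (j == (i + k.+1)%N :> nat)%:R.
Proof.
pose v i := \sum_(j < n) c j 0 * hfun k grid j.+1 (grid i.+1).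
have -> : spline_mx *m c = \col_i v i.
  by apply/colP => r; rewrite !mxE; apply: eq_bigr => j _; rewrite mxE mulrC.
rewrite mul_diff_mx_col iter_fdiff_sum mulr_sumr.
by apply: eq_bigr => j _; rewrite iter_fdiff_hfun mulrCA.
Qed.

Lemma l1norm_diff_spline (c : 'cV[R]_n) :
  l1norm (diff_mx R n k.+1 *m (spline_mx *m c)) =
  k`!%:R / n%:R ^+ k * \sum_(j < n | (k < j)%N) `|c j 0|.
Proof.
have kn0 : 0 <= k`!%:R / n%:R ^+ k :> R by rewrite divr_ge0 ?exprn_ge0.
pose m := iter k.+1 predn n; have mE : m = (n - k.+1)%N by exact: iter_predn.
rewrite /l1norm (eq_bigr (fun i : 'I_m => k`!%:R / n%:R ^+ k *
    \sum_j `|c j 0| * (j == (i + k.+1)%N :> nat)%:R)); last first.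
  move=> i _; rewrite diff_spline_mx normrM (ger0_norm kn0); congr (_ * _).
  have im : (i + k.+1 < n)%N by have := leq_trans (ltn_ord i) (eq_leq mE); lia.
  by rewrite (sumr_delta (fun j => c j 0) im) (sumr_delta (fun j => `|c j 0|) im).
rewrite -mulr_sumr exchange_big /= [in RHS]big_mkcond /=; congr (_ * _).
apply: eq_bigr => j _; rewrite -mulr_sumr; case: ltnP => kj.
  have jm : (j - k.+1 < m)%N by rewrite mE; have := ltn_ord j; lia.
  rewrite (bigD1 (Ordinal jm)) //= subnK// eqxx big1 ?addr0 ?mulr1// => i /negP ij.
  rewrite (_ : _ == _ = false)//; apply/negP => /eqP jE; apply: ij.
  by apply/eqP/val_inj => /=; rewrite jE addnK.
rewrite big1 ?mulr0// => i _; rewrite (_ : _ == _ = false)//.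
by apply/negP => /eqP; lia.
Qed.

(** Differences of order [k+1] of the values are multiples of the coefficients
    of the truncated products, so these coefficients are zero; what remains is
    a polynomial of degree less than [n] with [n] roots. *)
Lemma spline_mx_inj (c : 'cV[R]_n) : spline_mx *m c = 0 -> c = 0.
Proof.
move=> Hc0.
have c0 (j : 'I_n) : (k < j)%N -> c j 0 = 0.
  move=> kj; have := l1norm_diff_spline c; rewrite Hc0 mulmx0.
  rewrite {1}/l1norm big1 => [/esym/eqP|i _]; last by rewrite mxE normr0.
  have kn0 : k`!%:R / n%:R ^+ k != 0 :> R.
    by rewrite mulf_neq0 ?invr_neq0 ?expf_neq0 // pnatr_eq0 -lt0n ?fact_gt0.
  rewrite mulf_eq0 (negPf kn0) /= psumr_eq0// => /allP/(_ j).
  by rewrite mem_index_enum kj normr_eq0 => /(_ isT)/eqP.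
pose p := \sum_(j < n) c j 0 *: 'X^j.
have pE i : (i < n)%N -> p.[grid i.+1] = 0.
  move=> i_n; have := congr1 (fun v : 'cV_n => v (Ordinal i_n) 0) Hc0.
  rewrite !mxE => <-; rewrite horner_sum; apply: eq_bigr => j _.
  rewrite mxE hfunE /basis_poly hornerZ mulrC; have [jk|kj] := leqP j k.
    by rewrite mulr1.
  by rewrite c0// !mulr0.
have p0 : p = 0.
  apply/eqP/negPn/negP => p0; have [] := negP (_ : ~~ (n < n)%N); first by rewrite ltnn.
  have szp : (size p <= n)%N.
    apply: (leq_trans (size_sum _ _ _)); apply/bigmax_leqP => j _.
    by rewrite (leq_trans (size_scale_leq _ _))// size_polyXn.
  rewrite (leq_trans _ szp)//.
  rewrite -[X in (X < _)%N](size_mkseq (fun i => grid i.+1)).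
  apply: max_poly_roots => //.
    by apply/allP => t /mapP[i]; rewrite mem_iota => i_n ->; rewrite /root pE.
  apply: mkseq_uniq => i j /eqP; rewrite eq_le !leNgt !grid_lt.
  by rewrite -!leqNgt -eqn_leq => /eqP[].
apply/colP => i; rewrite mxE; have := coef0 R i; rewrite -p0 coef_sum => <-.
rewrite (bigD1 i)//= coefZ coefXn eqxx mulr1 big1 ?addr0// => j ji.
by rewrite coefZ coefXn eq_sym (negPf (ji : val _ != val _)) mulr0.
Qed.

Lemma spline_mx_unit : spline_mx \in unitmx.
Proof.
rewrite -unitmx_tr -row_free_unit; apply: inj_row_free => v v0.
have := @spline_mx_inj v^T; rewrite -[spline_mx *m _]trmxK trmx_mul trmxK v0 trmx0.
by move=> /(_ erefl) /(congr1 trmx); rewrite trmxK trmx0.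
Qed.

End EvenGrid.

(** * Penalized least squares has exactly one minimizer *)

Section PenalizedLeastSquares.
Variables (R : realType) (m n : nat) (A : 'M[R]_(m, n)) (y : 'cV[R]_n) (c : R).
Hypothesis c0 : 0 <= c.

Let F (b : 'cV[R]_n) : R := 2^-1 * sql2norm (y - b) + c * l1norm (A *m b).

Lemma l1norm_ge0 p (v : 'cV[R]_p) : 0 <= l1norm v.
Proof. by apply: sumr_ge0. Qed.

Lemma sql2norm_eq0 p (v : 'cV[R]_p) : sql2norm v = 0 -> v = 0.
Proof.
move/eqP; rewrite psumr_eq0; last by move=> i _; exact: sqr_ge0.
move=> /allP v0; apply/colP => i; rewrite mxE.
by have := v0 i; rewrite mem_index_enum sqrf_eq0 => /(_ isT)/eqP.
Qed.

Lemma l1norm_midpoint p (u v : 'cV[R]_p) :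
  l1norm (2^-1 *: (u + v)) <= 2^-1 * (l1norm u + l1norm v).
Proof.
rewrite /l1norm -big_split mulr_sumr /=; apply: ler_sum => i _.
rewrite !mxE normrM ger0_norm ?invr_ge0// ler_wpM2l ?invr_ge0//.
exact: ler_normD.
Qed.

Lemma sql2norm_midpoint p (u v : 'cV[R]_p) :
  sql2norm (2^-1 *: (u + v)) =
  2^-1 * (sql2norm u + sql2norm v) - 4^-1 * sql2norm (u - v).
Proof.
rewrite /sql2norm -big_split !mulr_sumr -sumrB /=; apply: eq_bigr => i _.
by rewrite !mxE; field.
Qed.

(** Strong convexity of the quadratic term: at the midpoint of two minimizers
    the objective would be smaller by an eighth of their squared distance. *)
Lemma penalized_ls_unique b1 b2 :
  (forall b, F b1 <= F b) -> (forall b, F b2 <= F b) -> b1 = b2.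
Proof.
move=> m1 m2; apply/eqP; rewrite -subr_eq0; apply/eqP/sql2norm_eq0/le_anti.
rewrite [X in _ && X]sumr_ge0 ?andbT; last by move=> i _; exact: sqr_ge0.
have := m1 (2^-1 *: (b1 + b2)); have := m2 b1; have := m1 b2.
have yE : y - 2^-1 *: (b1 + b2) = 2^-1 *: ((y - b1) + (y - b2)).
  by apply/colP => i; rewrite !mxE; field.
have dE : sql2norm ((y - b1) - (y - b2)) = sql2norm (b1 - b2).
  by apply: eq_bigr => i _; rewrite !mxE; ring.
have := ler_wpM2l c0 (l1norm_midpoint (A *m b1) (A *m b2)).
rewrite /F yE sql2norm_midpoint dE -scalemxAr mulmxDr.
set s := sql2norm (b1 - b2); set p := l1norm (2^-1 *: _).
by rewrite mulrCA mulrDr; move: (c * p) => cp; lra.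
Qed.

Lemma continuous_penalized_ls : continuous (fun v : 'rV[R]_n => F v^T).
Proof.
have sumC (I : finType) (f : I -> 'rV[R]_n -> R) :
    (forall i, continuous (f i)) -> continuous (fun v => \sum_i f i v).
  by move=> cf; apply: continuous_big => //; exact: add_continuous.
have coordC i : continuous (fun v : 'rV[R]_n => v^T i 0).
  move=> v; under eq_fun do rewrite mxE; exact: coord_continuous.
have cstM (a : R) (f : 'rV[R]_n -> R) :
    continuous f -> continuous (fun v => a * f v).
  move=> cf v; apply: (@continuousM _ _ (fun=> a) f v _ (cf v)); exact: cst_continuous.
have addC (f g : 'rV[R]_n -> R) :
    continuous f -> continuous g -> continuous (fun v => f v + g v).
  by move=> cf cg v; exact: (@continuousD _ _ _ f g v (cf v) (cg v)).
apply: addC; apply/cstM; apply/sumC => i.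
  move=> v; under eq_fun do rewrite !mxE.
  have yC : {for v, continuous (fun w : 'rV[R]_n => y i 0 - w 0 i)}.
    apply: (@continuousB _ _ _ (fun=> y i 0) (fun w : 'rV[R]_n => w 0 i)).
      exact: cst_continuous.
    exact: coord_continuous.
  exact: (@continuousM _ _ _ _ v yC yC).
have rowC : continuous (fun v : 'rV[R]_n => (A *m v^T) i 0).
  by under eq_fun do rewrite mxE; apply/sumC => j; apply/cstM/coordC.
by move=> v; apply: continuous_comp; [exact: rowC|exact: norm_continuous].
Qed.

(** Outside a large box around [y] the quadratic term alone exceeds the value of
    the objective at 0, so a minimizer on the box is a global one. *)
Lemma penalized_ls_argmin : exists b, argmin [set: 'cV[R]_n] F = [set b].
Proof.
pose M := 1 + 2 * F 0.
have F0 : 0 <= F 0.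
  rewrite addr_ge0// mulr_ge0 ?l1norm_ge0 ?invr_ge0// sumr_ge0// => i _.
  exact: sqr_ge0.
(* the box is enlarged by |y_i| so that it contains the origin *)
pose I (i : 'I_n) : set R := `[y i 0 - M - `|y i 0|, y i 0 + M + `|y i 0| ]%classic.
pose S := [set v : 'rV[R]_n | forall i, I i (v ord0 i)].
have S0 : S 0.
  move=> i; rewrite /I /= mxE in_itv /= /M.
  by have := ler_norm (y i 0); have := ler_norm (- y i 0); rewrite normrN; lra.
have [v _ vmin] : exists2 v, v \in S & forall w, w \in S -> F v^T <= F w^T.
  apply: (compact_EVT_min (f := fun v : 'rV[R]_n => F v^T)); first by exists 0.
    by apply: (@rV_compact _ _ I) => i; exact: segment_compact.
  exact/continuous_subspaceT/continuous_penalized_ls.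
have bmin b : F v^T <= F b.
  have [bS|] := pselect (S b^T).
    by have := vmin _ (mem_set bS); rewrite trmxK.
  move=> /existsNP[i /= bS]; have := vmin _ (mem_set S0); rewrite trmx0.
  move=> /le_trans; apply; apply: (@le_trans _ _ (2^-1 * M ^+ 2)).
    by rewrite /M; move: (F 0) F0 => f f0; nra.
  have Mi : M ^+ 2 <= (y i 0 - b i 0) ^+ 2.
    move/negP: bS; rewrite /I /= mxE in_itv/= negb_and -!ltNge /M; have := normr_ge0 (y i 0).
    by move: (F 0) F0 => f f0 ny /orP[]; nra.
  apply: (@le_trans _ _ (2^-1 * sql2norm (y - b))); last first.
    by rewrite /F lerDl mulr_ge0 ?l1norm_ge0.
  rewrite ler_pM2l ?invr_gt0// (le_trans Mi)// /sql2norm (bigD1 i) //= !mxE lerDl.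
  by rewrite sumr_ge0// => j _; exact: sqr_ge0.
exists v^T; apply/seteqP; split => [b [_ bm]|_ ->]; last by split.
by apply: penalized_ls_unique => // b'; exact: bm.
Qed.

End PenalizedLeastSquares.

(** * A smooth bump function *)

Section Smooth.
Variable R : realType.
Implicit Types (f g : R -> R) (p q : {poly R}).

Definition smooth f := forall m t, derivable (derive1n m f) t 1.

Lemma derive1Sn m f : derive1n m.+1 f = derive1n m (derive1 f).
Proof. by rewrite /derive1n iterSr. Qed.

(** Coinduction for smoothness: membership in a class of differentiable
    functions stable under differentiation is enough. *)
Lemma smooth_of_stable_class (C : set (R -> R)) :
  (forall f, C f -> (forall t, derivable f t 1) /\ C (derive1 f)) ->
  forall f, C f -> smooth f.
Proof.
move=> CD f Cf m; elim: m f Cf => [|m IH] f /CD[df Cf'] //.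
by rewrite derive1Sn; exact: IH.
Qed.

(** The classical function [exp (-1/t)] extended by 0, times a polynomial in
    [1/t]: the polynomial factor makes the family stable under
    differentiation. *)
Definition flat_exp p (t : R) : R := if 0 < t then p.[t^-1] * expR (- t^-1) else 0.

Definition flat_exp_deriv p : {poly R} := 'X^2 * (p - p^`()).

(** Put [u = 1/t]: the bound says that [|p(u)| u] is at most a multiple of
    [exp u], which holds term by term because [u^n <= n! exp u]. *)
Lemma flat_exp_le p : exists c, forall t, `|flat_exp p t| <= c * `|t|.
Proof.
exists (\sum_(i < size p) `|p`_i| * i.+1`!%:R) => t.
rewrite /flat_exp; case: ltP => t0; last first.
  by rewrite normr0 mulr_ge0// sumr_ge0// => i _; rewrite mulr_ge0.
rewrite normrM (ger0_norm (expR_ge0 _)) (gtr0_norm t0) expRN.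
rewrite ler_pdivrMr ?expR_gt0// -mulrA mulr_suml.
rewrite horner_coef (le_trans (ler_norm_sum _ _ _))//; apply: ler_sum => i _.
rewrite normrM -mulrA ler_wpM2l// normrX gtr0_norm ?invr_gt0//.
have ti0 : 0 <= t^-1 by rewrite invr_ge0 ltW.
have := expR_ge1Dxn i ti0; rewrite -[in X in X -> _]lerBrDl => h.
have {h} : t^-1 ^+ i.+1 <= i.+1`!%:R * expR t^-1.
  rewrite mulrC -ler_pdivrMr ?ltr0n ?fact_gt0// (le_trans h)// lerBlDr lerDl.
  exact: ler01.
rewrite exprSr ler_pdivrMr// => h; rewrite (le_trans h)//.
by rewrite mulrA mulrAC.
Qed.

Lemma continuous_flat_exp0 p : {for 0, continuous (flat_exp p)}.
Proof.
have [c cP] := flat_exp_le p.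
have f0 : flat_exp p 0 = 0 by rewrite /flat_exp ltxx.
apply/cvgrPdist_le => e e0; rewrite f0; near=> t.
rewrite sub0r normrN (le_trans (cP t))//.
have c1 : 0 < 1 + `|c| by rewrite ltr_pwDl.
rewrite (@le_trans _ _ ((1 + `|c|) * `|t|))//.
  by rewrite ler_wpM2r// (le_trans (ler_norm c))// lerDr.
rewrite mulrC -ler_pdivlMr//; near: t.
apply/nbhs_normP; exists (e / (1 + `|c|)); first by rewrite /= divr_gt0.
by move=> t /=; rewrite sub0r normrN => /ltW.
Unshelve. all: by end_near. Qed.

(** At 0 the difference quotient of [flat_exp p] is [flat_exp ('X * p)], a
    function of the same family, which tends to 0. *)
Lemma is_derive_flat_exp p (t : R) : is_derive t 1 (flat_exp p) (flat_exp (flat_exp_deriv p) t).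
Proof.
have [t0|t0|->] := ltgtP t 0.
- have : \forall s \near t, cst 0 s = flat_exp p s.
    by near=> s; rewrite /flat_exp ifN// -leNgt ltW//; near: s; exact: lt_nbhsl.
  move=> /near_eq_is_derive; apply.
  by rewrite /flat_exp ifN -?leNgt ?(ltW t0)//; exact: is_derive_cst.
- have : \forall s \near t, p.[s^-1] * expR (- s^-1) = flat_exp p s.
    by near=> s; rewrite /flat_exp ifT//; near: s; exact: lt_nbhsr.
  move=> /near_eq_is_derive; apply.
  rewrite /flat_exp t0 /flat_exp_deriv.
  have tV : is_derive t 1 (fun s : R => s^-1) (- t ^- 2).
    have := @is_deriveV _ id t 1 1; rewrite gt_eqF// => /(_ isT).
    by rewrite /GRing.scale /= mulr1; apply; exact: is_derive_id.
  have pV : is_derive t 1 (horner p \o (fun s : R => s^-1)) (p^`().[t^-1] * - t ^- 2).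
    exact: is_derive1_comp.
  have eV : is_derive t 1 (expR \o (-%R \o (fun s : R => s^-1)))
      (expR (- t^-1) * (-1 * - t ^- 2)).
    exact: is_derive1_comp.
  apply: (is_derive_eq (is_deriveM pV eV)).
  by rewrite /GRing.scale /= !hornerE/=; rewrite exprVn; ring.
- apply/is_derive1_caratheodory; exists (flat_exp ('X * p)); split.
  + move=> z; rewrite /flat_exp ltxx !subr0; case: ltP => z0; last by rewrite mul0r.
    by rewrite hornerM hornerX; field; rewrite gt_eqF.
  + exact: continuous_flat_exp0.
  + by rewrite /flat_exp ltxx.
Unshelve. all: by end_near. Qed.

(** By the Leibniz rule the products alone are not stable under
    differentiation, but their finite sums are. *)
Inductive bump_class (a b : R) : (R -> R) -> Prop :=
| bump_prod p q : bump_class a b (fun t => flat_exp p (t - a) * flat_exp q (b - t))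
| bump_add f g : bump_class a b f -> bump_class a b g ->
    bump_class a b (fun t => f t + g t).

Lemma bump_class_derive a b f : bump_class a b f ->
  (forall t, derivable f t 1) /\ bump_class a b (derive1 f).
Proof.
elim=> {f} [p q|f g _ [df Cf] _ [dg Cg]]; last first.
  split=> [t|]; first exact: derivableD.
  suff -> : derive1 (fun t => f t + g t) = fun t => derive1 f t + derive1 g t.
    exact: bump_add.
  by apply/funext => t; rewrite !derive1E deriveD.
have D (t : R) : is_derive t 1 (fun t => flat_exp p (t - a) * flat_exp q (b - t))
   (flat_exp (flat_exp_deriv p) (t - a) * flat_exp q (b - t)
     + flat_exp p (t - a) * flat_exp (- flat_exp_deriv q) (b - t)).
  have fp : is_derive t 1 (flat_exp p \o (fun t => t - a)) (flat_exp (flat_exp_deriv p) (t - a) * (1 - 0)).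
    apply: is_derive1_comp; exact: is_derive_flat_exp.
  have fq : is_derive t 1 (flat_exp q \o (fun t => b - t)) (flat_exp (flat_exp_deriv q) (b - t) * (0 - 1)).
    apply: is_derive1_comp; exact: is_derive_flat_exp.
  apply: (is_derive_eq (is_deriveM fp fq)).
  rewrite /GRing.scale /= [flat_exp (- _) _](_ : _ = - flat_exp (flat_exp_deriv q) (b - t)).
    by ring.
  by rewrite /flat_exp; case: ifP; rewrite ?oppr0// hornerN mulNr.
split=> [t|]; first by case: (D t).
have -> : derive1 (fun t => flat_exp p (t - a) * flat_exp q (b - t)) = fun t =>
    flat_exp (flat_exp_deriv p) (t - a) * flat_exp q (b - t)
      + flat_exp p (t - a) * flat_exp (- flat_exp_deriv q) (b - t); last first.
  by apply: bump_add; exact: bump_prod.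
by apply/funext => t; rewrite derive1E derive_val.
Qed.

Lemma smooth_bump a b : exists2 f, smooth f & forall t,
  0 <= f t /\ (f t != 0) = (a < t < b).
Proof.
exists (fun t => flat_exp 1 (t - a) * flat_exp 1 (b - t)).
  by apply: (smooth_of_stable_class (@bump_class_derive a b)); exact: bump_prod.
have f1 t : 0 <= flat_exp 1 t /\ (flat_exp 1 t != 0) = (0 < t).
  rewrite /flat_exp; case: ifP; rewrite ?eqxx// hornerE mul1r => _.
  by rewrite expR_ge0 gt_eqF ?expR_gt0.
move=> t; have [? ta] := f1 (t - a); have [? tb] := f1 (b - t).
by rewrite mulr_ge0// mulf_eq0 negb_or ta tb !subr_gt0.
Qed.

End Smooth.

(** * Test functions and linearity of weak derivatives *)

Section TestFunctions.
Variable R : realType.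
Notation mu := (@lebesgue_measure R).
Implicit Types (U : set R) (f g phi : R -> R).

Lemma smooth_continuous phi m : smooth phi -> continuous (derive1n m phi).
Proof.
move=> sphi t; apply: differentiable_continuous.
exact/derivable1_diffP/sphi.
Qed.

(** The complement of the closed support is open, and on it the function and
    hence all its derivatives are locally zero. *)
Lemma derive1n_support phi m :
  [set t | derive1n m phi t != 0] `<=` closure [set t | phi t != 0].
Proof.
move=> t /eqP; apply: contra_notP; elim: m t => [|m IH] t st.
  by apply/eqP/negPn/negP => phit; apply: st; exact: subset_closure.
rewrite derive1nS derive1E (near_eq_derive (g := cst 0)) ?derive_cst//.
have : open_nbhs t (~` closure [set t | phi t != 0]).
  by split => //; exact/closed_openC/closed_closure.
by move=> /open_nbhs_nbhs; apply: filterS => s; exact: IH.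
Qed.

Lemma test_function_derive1n U phi m :
  test_function U phi -> test_function U (derive1n m phi).
Proof.
move=> [sphi cphi phiU].
have ss : closure [set t | derive1n m phi t != 0] `<=`
          closure [set t | phi t != 0].
  rewrite [X in _ `<=` X](iffLR (closure_id _)); last exact: closed_closure.
  exact/closureS/derive1n_support.
split; last exact: subset_trans phiU.
  by move=> j t; rewrite /derive1n -iterD; exact: sphi.
by apply: subclosed_compact ss => //; exact: closed_closure.
Qed.

Lemma test_function_out U phi t : test_function U phi -> ~ U t -> phi t = 0.
Proof.
move=> [_ _ phiU] Ut; apply/eqP/negPn/negP => p0; apply: Ut; apply: phiU.
exact: subset_closure.
Qed.

(** Outside the support the product is zero, and on the support, which is compact,
    the test function is bounded. *)
Lemma integrable_test U f phi : locally_integrable U f ->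
  test_function U phi -> mu.-integrable U (EFin \o (fun t => f t * phi t)).
Proof.
move=> [mf oU lf] [sphi cphi phiU].
set K := closure _ in cphi phiU.
have mK : measurable K by exact: compact_measurable.
have mU : measurable U by exact: open_measurable.
apply/integrable_mkcond => //.
rewrite (_ : _ \_ U = ((EFin \o f) \* (EFin \o phi)) \_ K)%E; last first.
  apply/funext => t; rewrite /patch; case: ifPn => tU; case: ifPn => tK //=.
    have /eqP -> : phi t == 0.
      apply/negPn/negP => p0; move/negP: tK; apply; apply/mem_set.
      exact: subset_closure.
    by rewrite mulr0.
  by have := phiU _ (set_mem tK); move/negP: tU; rewrite inE.
have mkc := integrable_mkcond (mu := mu) ((EFin \o f) \* (EFin \o phi))%E mK.
apply/mkc; apply: integrableMl => //.
- apply/integrableP; split; last by apply: lf.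
  by apply/measurable_EFinP; exact: measurable_funS mf.
- apply: measurable_funTS; apply: continuous_measurable_fun.
  exact: (smooth_continuous (m := 0)).
- have : {within K, continuous phi}.
    by apply: continuous_subspaceT; exact: (smooth_continuous (m := 0)).
  move=> /continuous_compact/(_ cphi)/compact_bounded[M [_ mrt]].
  by exists M; split; rewrite ?num_real// => z /mrt h t Kt;
    by apply: h; exists t.
Qed.

Lemma is_weak_derivative_eq U k f f' g g' :
  {in U, f =1 f'} -> {in U, g =1 g'} ->
  is_weak_derivative U k f g -> is_weak_derivative U k f' g'.
Proof.
have lie h h' : {in U, h =1 h'} -> locally_integrable U h ->
    locally_integrable U h'.
  move=> hh' [mh oU lh]; split=> //; first exact: eq_measurable_fun mh.
  move=> K KU cK; rewrite (le_lt_trans _ (lh _ KU cK))// le_eqVlt; apply/orP; left.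
  by apply/eqP/eq_integral => t /set_mem /KU /mem_set tU; rewrite hh'.
move=> ff' gg' [lf lg fg]; split; [exact: lie lf|exact: lie lg|].
move=> phi tphi.
have -> : \int[mu]_(t in U) (f' t * derive1n k phi t) =
          \int[mu]_(t in U) (f t * derive1n k phi t).
  by apply: eq_Rintegral => t tU; rewrite ff'.
rewrite fg//; congr (_ * _); apply: eq_Rintegral => t tU.
by rewrite gg'.
Qed.

Lemma is_weak_derivativeD U k f f' g g' :
  is_weak_derivative U k f g -> is_weak_derivative U k f' g' ->
  is_weak_derivative U k (f \+ f') (g \+ g').
Proof.
move=> [lf lg fg] [lf' lg' fg']; split; [exact: locally_integrableD..|].
move=> phi tphi; have mU : measurable U by case: lf => _ /open_measurable.
under eq_Rintegral do rewrite /= mulrDl.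
under [in RHS]eq_Rintegral do rewrite /= mulrDl.
have tk := test_function_derive1n k tphi.
by rewrite !RintegralD ?fg ?fg' ?mulrDr//; exact: integrable_test.
Qed.

Lemma is_weak_derivativeZ U k a f g : is_weak_derivative U k f g ->
  is_weak_derivative U k (fun t => a * f t) (fun t => a * g t).
Proof.
have liZ h : locally_integrable U h -> locally_integrable U (fun t => a * h t).
  move=> [mh oU lh]; split=> //; first exact: measurable_funM.
  move=> K KU cK; have mK := compact_measurable cK.
  have mU : measurable U by exact: open_measurable.
  under eq_integral do rewrite normrM EFinM.
  rewrite ge0_integralZl_EFin//; first by rewrite lte_mul_pinfty ?lh.
  by apply/measurable_EFinP; apply: measurableT_comp => //; exact: measurable_funS mh.
move=> [lf lg fg]; split; [exact: liZ..|].
move=> phi tphi; have mU : measurable U by case: lf => _ /open_measurable.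
under eq_Rintegral do rewrite /= -mulrA.
under [in RHS]eq_Rintegral do rewrite /= -mulrA.
have tk := test_function_derive1n k tphi.
by rewrite !RintegralZl ?fg 1?mulrCA//; exact: integrable_test.
Qed.

Lemma is_weak_derivative0 U k : open U ->
  is_weak_derivative U k (fun=> 0) (fun=> 0).
Proof.
move=> oU; have l0 : locally_integrable U (fun=> 0 : R).
  by split=> // K _ _; under eq_integral do rewrite normr0; rewrite integral0.
split=> // phi _; under eq_Rintegral do rewrite mul0r.
by under [in RHS]eq_Rintegral do rewrite mul0r; rewrite /Rintegral integral0 mulr0.
Qed.

Lemma is_weak_derivative_sum U k n (a : 'I_n -> R) (f g : 'I_n -> R -> R) :
  open U -> (forall j, is_weak_derivative U k (f j) (g j)) ->
  is_weak_derivative U k (fun t => \sum_j a j * f j t)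
                         (fun t => \sum_j a j * g j t).
Proof.
move=> oU fg; elim: n a f g fg => [|n IH] a f g fg.
  have E h : (fun t => \sum_j a j * h j t) = fun=> 0 :> R.
    by apply/funext => t; rewrite big_ord0.
  by rewrite !E; exact: is_weak_derivative0.
have E h : (fun t => \sum_j a j * h j t) =
    (fun t => \sum_(j < n) a (widen_ord (leqnSn n) j) * h (widen_ord (leqnSn n) j) t)
    \+ (fun t => a ord_max * h ord_max t) :> (R -> R).
  by apply/funext => t; rewrite big_ord_recr.
rewrite !E.
apply: is_weak_derivativeD; last exact: is_weak_derivativeZ.
exact: (IH _ (fun j => f (widen_ord (leqnSn n) j))
  (fun j => g (widen_ord (leqnSn n) j))).
Qed.

End TestFunctions.

(** * Weak derivatives of truncated polynomials, and their uniqueness *)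

Section TruncatedPolynomials.
Variable R : realType.
Notation mu := (@lebesgue_measure R).
Implicit Types (U : set R) (f g phi : R -> R) (p : {poly R}).

Lemma derivable_oo_LR f a b :
  (forall t, derivable f t 1) -> derivable_oo_LRcontinuous f a b.
Proof.
move=> df; have cf t : f s @[s --> t] --> f t.
  exact/differentiable_continuous/derivable1_diffP.
by split=> [t _//||]; [apply: cvg_at_right_filter|apply: cvg_at_left_filter].
Qed.

(** There are no boundary terms, because a test function on [U] is zero at the
    points that do not belong to [U]. *)
Lemma Rintegral_by_parts_test U p s phi : s < 1 -> ~ U s -> ~ U 1 ->
  test_function U phi ->
  \int[mu]_(t in `[s, 1]) (p.[t] * derive1 phi t) =
  - \int[mu]_(t in `[s, 1]) (p^`().[t] * phi t).
Proof.
move=> s1 Us U1 tphi; have sphi : smooth phi by case: tphi.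
rewrite (@Rintegration_by_parts _ (horner p) phi (horner p^`()))//.
- by rewrite !(test_function_out tphi)// !mulr0 subrr sub0r.
- exact/continuous_subspaceT/continuous_horner.
- apply: derivable_oo_LR => t; exact: derivable_horner.
- by move=> t _; rewrite derivE.
- exact/continuous_subspaceT/(smooth_continuous (m := 1)).
- apply: derivable_oo_LR; exact: (sphi 0%N).
Qed.

Lemma Rintegral_derive1n_test U p s phi k : s < 1 -> ~ U s -> ~ U 1 ->
  test_function U phi ->
  \int[mu]_(t in `[s, 1]) (p.[t] * derive1n k phi t) =
  (-1) ^+ k * \int[mu]_(t in `[s, 1]) ((p^`(k)).[t] * phi t).
Proof.
move=> s1 Us U1 tphi; elim: k p => [|k IH] p; first by rewrite mul1r.
under eq_Rintegral do rewrite derive1nS.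
rewrite (Rintegral_by_parts_test p s1 Us U1 (test_function_derive1n k tphi)).
by rewrite IH derivSn exprS mulN1r mulNr.
Qed.

(** As [phi] is zero off [U], the domain of integration may be changed at will
    off [U]: it becomes a segment, on which integration by parts is available,
    and [U] may have any number of components. *)
Lemma Rintegral_trunc U p s phi : U `<=` `]0, 1[ -> ~ U s ->
  (forall t, ~ U t -> phi t = 0) ->
  \int[mu]_(t in U) (p.[t] * (s < t)%R%:R * phi t) =
  \int[mu]_(t in `[s, 1]) (p.[t] * phi t).
Proof.
move=> U01 Us phi0; rewrite Rintegral_mkcond [RHS]Rintegral_mkcond.
apply: eq_Rintegral => t _; rewrite /patch mem_setE in_itv /=.
have [|tU] := boolP (t \in U).
  rewrite inE => tU; have /andP[_ t1] : 0 < t < 1 by have := U01 _ tU; rewrite /= in_itv.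
  rewrite (ltW t1) andbT le_eqVlt (_ : (s == t) = false) /=.
    by case: ifP; rewrite ?mulr1// mulr0 mul0r.
  by apply/eqP => st; apply: Us; rewrite st.
by rewrite phi0 ?mulr0 ?if_same// => /mem_set; apply/negP.
Qed.

Lemma locally_integrable_trunc U p s : open U -> U `<=` `]0, 1[ ->
  locally_integrable U (fun t => p.[t] * (s < t)%R%:R).
Proof.
move=> oU U01; apply: open_integrable_locally => //.
apply: (@integrableS _ _ _ mu `[0, 1]%classic) => //; first exact: open_measurable.
  by move=> t /U01; apply: subset_itv_oo_cc.
rewrite (_ : _ \o _ = (EFin \o horner p) \* (EFin \o (\1_(`]s, +oo[))))%E; last first.
  by apply/funext => t /=; rewrite indicE mem_setE in_itv /= andbT.
apply: integrableMl => //.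
- apply: continuous_compact_integrable; first exact: segment_compact.
  exact/continuous_subspaceT/continuous_horner.
- exists 1; split; rewrite ?num_real// => z z1 t _ /=.
  by rewrite indicE; case: (_ \in _); rewrite ?normr1 ?normr0 ltW// (lt_trans _ z1).
Qed.

(** This is where deleting the knots from the domain matters: a truncation at a
    point [s] of [U] would in general contribute point masses there. *)
Lemma is_weak_derivative_trunc U p s k : open U -> U `<=` `]0, 1[ ->
  s < 1 -> ~ U s ->
  is_weak_derivative U k (fun t => p.[t] * (s < t)%R%:R)
                         (fun t => (p^`(k)).[t] * (s < t)%R%:R).
Proof.
move=> oU U01 s1 Us; split; [exact: locally_integrable_trunc..|].
move=> phi tphi; have U1 : ~ U 1 by move=> /U01; rewrite /= in_itv /= ltxx andbF.
rewrite (Rintegral_trunc _ U01 Us (fun t => test_function_out tphi (t := t))).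
rewrite (Rintegral_trunc _ U01 Us
  (fun t => test_function_out (test_function_derive1n k tphi) (t := t))).
exact: (Rintegral_derive1n_test _ _ s1 Us U1 tphi).
Qed.

Lemma bump_test U a b phi : `[a, b] `<=` U -> smooth phi ->
  (forall t, (phi t != 0) = (a < t < b)) -> test_function U phi.
Proof.
move=> abU sphi phiE.
have cl : closure [set t | phi t != 0] `<=` `[a, b].
  have /closure_id -> : closed `[a, b]%classic by exact: itv_closed.
  by apply: closureS => t /=; rewrite phiE in_itv /= => /andP[/ltW-> /ltW->].
split=> //; last exact: subset_trans abU.
by apply: subclosed_compact cl; [exact: closed_closure|exact: segment_compact].
Qed.

(** By compactness the bump is bounded below by a positive constant on the middle
    third of its support. *)
Lemma Rintegral_bump_gt0 U a b phi : measurable U -> a < b -> `[a, b] `<=` U ->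
  continuous phi -> mu.-integrable U (EFin \o phi) ->
  (forall t, 0 <= phi t /\ (phi t != 0) = (a < t < b)) ->
  0 < \int[mu]_(t in U) phi t.
Proof.
move=> mU ab abU cphi iphi phiE.
pose a' := (2 * a + b) / 3; pose b' := (a + 2 * b) / 3.
have aa' : a < a' by rewrite /a'; lra.
have a'b' : a' < b' by rewrite /a' /b'; lra.
have b'b : b' < b by rewrite /b'; lra.
have [c] := EVT_min (ltW a'b') (continuous_subspaceT cphi).
rewrite in_itv /= => /andP[a'c cb'] cmin.
have c0 : 0 < phi c.
  have [c0 cE] := phiE c; rewrite lt_def c0 cE (lt_le_trans aa')//.
  by rewrite (le_lt_trans cb').
have sub : `[a', b'] `<=` U.
  move=> t /=; rewrite in_itv /= => /andP[a't tb']; apply: abU.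
  by rewrite /= in_itv /= (ltW (lt_le_trans aa' a't)) (ltW (le_lt_trans tb' b'b)).
have m' : measurable (`[a', b']%classic : set R) by [].
apply: (@lt_le_trans _ _ (\int[mu]_(t in `[a', b']) phi c)).
  rewrite Rintegral_cst//= lebesgue_measure_itv /= lte_fin a'b' -EFinB /=.
  by rewrite mulr_gt0// subr_gt0.
apply: (@le_trans _ _ (\int[mu]_(t in `[a', b']) phi t)).
  apply: le_Rintegral => //; last exact: integrableS iphi.
  by apply: continuous_compact_integrable; [exact: segment_compact|exact: cst_continuous].
rewrite -(setIidl sub) Rintegral_mkcondl.
apply: le_Rintegral => //; last first.
  by move=> t _; rewrite /patch; case: ifP => // _; case: (phiE t).
rewrite -restrict_EFin; apply/integrable_restrict => //.
by rewrite (setIidr sub); exact: integrableS iphi.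
Qed.

(** The only form of uniqueness of weak derivatives that the total variation
    needs: two weak derivatives [g] and [h] have the same integral against a
    nonnegative bump supported in [[a, b]], so [h] cannot stay below the
    constant value [c] of [g] by a margin [e] there. *)
Lemma weak_derivative_ge U k f g h a b c e : 0 < e -> a < b -> `[a, b] `<=` U ->
  is_weak_derivative U k f g -> is_weak_derivative U k f h ->
  (forall t, a <= t <= b -> g t = c) ->
  exists2 t, a <= t <= b & c - e <= h t.
Proof.
move=> e0 ab abU [_ lg fg] [_ lh fh] gc.
have [phi sphi phiE] := smooth_bump a b.
have tphi : test_function U phi.
  by apply: (bump_test abU) => // t; case: (phiE t).
have mU : measurable U by case: lg => _ /open_measurable.
have oU : open U by case: lg.
have l1 r : locally_integrable U (fun=> r : R).
  split=> // K KU cK; have mK := compact_measurable cK.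
  rewrite integral_cst//; apply: lte_mul_pinfty => //.
  exact: compact_finite_measure.
have i1 r := integrable_test (l1 r) tphi.
have iphi : mu.-integrable U (EFin \o phi).
  by have := i1 1; under eq_fun do rewrite /= mul1r.
have I0 := Rintegral_bump_gt0 mU ab abU (smooth_continuous (m := 0) sphi) iphi phiE.
apply: contrapT => noh.
have hg : \int[mu]_(t in U) (h t * phi t) = \int[mu]_(t in U) (g t * phi t).
  apply: (@mulfI _ ((-1) ^+ k)); first by rewrite signr_eq0.
  by rewrite -fh// fg.
have gE : \int[mu]_(t in U) (g t * phi t) = c * \int[mu]_(t in U) phi t.
  rewrite -RintegralZl//; apply: eq_Rintegral => t _.
  have [p0 pE] := phiE t; have [->|] := eqVneq (phi t) 0; first by rewrite !mulr0.
  by rewrite pE => /andP[/ltW ta /ltW tb]; rewrite gc// ta.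
suff : \int[mu]_(t in U) (h t * phi t) <= (c - e) * \int[mu]_(t in U) phi t.
  by rewrite hg gE ler_pM2r// lerDl oppr_ge0 leNgt e0.
rewrite -RintegralZl//; apply: le_Rintegral => //; first exact: integrable_test.
move=> t _; have [p0 pE] := phiE t.
have [->|] := eqVneq (phi t) 0; first by rewrite !mulr0.
rewrite pE => /andP[/ltW ta /ltW tb]; rewrite ler_wpM2r// leNgt; apply/negP => ct.
by apply: noh; exists t; rewrite ?ta// ltW.
Qed.

Lemma weak_derivative_le U k f g h a b c e : 0 < e -> a < b -> `[a, b] `<=` U ->
  is_weak_derivative U k f g -> is_weak_derivative U k f h ->
  (forall t, a <= t <= b -> g t = c) ->
  exists2 t, a <= t <= b & h t <= c + e.
Proof.
move=> e0 ab abU fg fh gc.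
have [|t tab ht] := weak_derivative_ge e0 ab abU (is_weak_derivativeZ (-1) fg)
  (is_weak_derivativeZ (-1) fh) (c := - c).
  by move=> t tab; rewrite mulN1r gc.
by exists t => //; move: ht; lra.
Qed.

End TruncatedPolynomials.

(** * Total variation of functions close to step functions *)

Section TotalVariation.
Variable R : realType.
Implicit Types (f h : R -> R).

Lemma total_variation_jump (x y a s : R) : x <= y ->
  (total_variation x y (fun t => a * (s < t)%R%:R)%R <= `|a|%:E)%E.
Proof.
move=> xy.
have nd b : 0 <= b -> {homo (fun t => b * (s < t)%R%:R : R) : u v / u <= v}.
  move=> b0 u v uv; apply: ler_wpM2l => //; case: ltP => //= su.
  by rewrite (lt_le_trans su uv).
have TVb b : 0 <= b ->
    (total_variation x y (fun t => b * (s < t)%R%:R)%R <= b%:E)%E.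
  move=> b0; rewrite nondecreasing_total_variation//; last first.
    by move=> u v _ _; exact: nd.
  rewrite lee_fin; do 2 case: ltP => _;
  by rewrite /= ?mulr1 ?mulr0; lra.
have [a0|a0] := leP 0 a; first by rewrite ger0_norm// TVb.
rewrite -total_variationN (_ : \- _ = fun t => - a * (s < t)%R%:R); last first.
  by apply/funext => t /=; rewrite mulNr.
by rewrite ltr0_norm// TVb// oppr_ge0 ltW.
Qed.

Lemma total_variation_jumps (x y c : R) n (a s : 'I_n -> R) : x <= y ->
  (total_variation x y (fun t => (c + \sum_j a j * (s j < t)%R%:R)%R) <=
   (\sum_j `|a j|)%:E)%E.
Proof.
move=> xy; elim: n a s => [|n IH] a s.
  rewrite big_ord0; have -> : (fun t => c + \sum_j a j * (s j < t)%R%:R) = cst c.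
    by apply/funext => t; rewrite big_ord0 addr0.
  by rewrite nondecreasing_total_variation// subrr.
rewrite big_ord_recr EFinD.
have -> : (fun t => c + \sum_j a j * (s j < t)%R%:R) =
  (fun t => c + \sum_(j < n) a (widen_ord (leqnSn n) j) *
    (s (widen_ord (leqnSn n) j) < t)%R%:R) \+
  (fun t => a ord_max * (s ord_max < t)%R%:R).
  by apply/funext => t; rewrite big_ord_recr /= addrA.
rewrite (le_trans (total_variation_le _ _ xy))// leeD//.
exact: total_variation_jump.
Qed.

Lemma sum_by_parts (u v : nat -> R) n :
  \sum_(r < n) u r.+1 * (v r.+1 - v r) =
  \sum_(r < n) (u r - u r.+1) * v r - u 0%N * v 0%N + u n * v n.
Proof.
elim: n => [|n IH]; first by rewrite !big_ord0; ring.
by rewrite !big_ord_recr /= IH; ring.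
Qed.

Lemma le_variation_points n (p t : nat -> R) h :
  (forall r, (r <= n)%N -> p r < t r < p r.+1) ->
  ((\sum_(r < n) `|h (t r.+1) - h (t r)|)%:E <=
    total_variation (p 0%N) (p n.+1) h)%E.
Proof.
move=> pt; pose s := rcons (mkseq t n.+1) (p n.+1).
have szs : size s = n.+2 by rewrite size_rcons size_mkseq.
have nths i : nth (p n.+1) s i = if (i <= n)%N then t i else p n.+1.
  rewrite nth_rcons size_mkseq ltnS; case: leqP => iN; first by rewrite nth_mkseq.
  by rewrite if_same.
have part : itv_partition (p 0%N) (p n.+1) s.
  split; last by rewrite last_rcons.
  apply/(pathP (p n.+1)) => i; rewrite szs ltnS leq_eqVlt => /orP[/eqP ->|].
    rewrite nths ltnn -[nth _ _ _]/(nth (p n.+1) s n) nths leqnn.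
    by case/andP: (pt n (leqnn n)).
  rewrite ltnS nths => iN; rewrite iN; case: i iN => [|i] iN /=.
    by case/andP: (pt 0%N iN).
  rewrite nths (ltnW iN); have /andP[_ h1] := pt i (ltnW iN).
  by have /andP[h2 _] := pt i.+1 iN; exact: lt_trans h2.
apply: (@le_trans _ _ (variation (p 0%N) (p n.+1) h s)%:E); last first.
  by apply: ereal_sup_ubound; exists (variation (p 0%N) (p n.+1) h s) => //; exists s.
rewrite lee_fin /variation szs; set F := h \o _.
have FE i : (i <= n)%N -> F i.+1 = h (t i) by move=> iN; rewrite /F /= nths iN.
rewrite big_nat_recr// big_nat_recl// big_mkord.
rewrite (eq_bigr (fun r : 'I_n => `|F r.+2 - F r.+1|)) => [|r _].
  by rewrite -[leLHS]add0r -[leLHS]addr0 !lerD.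
by rewrite !FE// ltnW.
Qed.

(** If [h] took the value [c r] in the [r]-th interval, these values would give
    the variation; it only comes close to [c r] from above and from below.  Let
    [u r] be the sign of the jump [c r - c r.-1], and 0 at both ends.  The
    difference between [\sum_r |c r.+1 - c r|] and
    [\sum_r u r.+1 * (h (t r.+1) - h (t r))], a lower bound for the variation of
    [h], is by summation by parts a sum of terms
    [(u r - u r.+1) * (c r - h (t r))].  Taking [t r] on the side dictated by the
    sign of [u r - u r.+1] bounds each of them above by a small number. *)
Lemma total_variation_ge_steps n (p c : nat -> R) h :
  (forall r e, (r <= n)%N -> 0 < e ->
    (exists2 t, p r < t < p r.+1 & c r - e <= h t) /\
    (exists2 t, p r < t < p r.+1 & h t <= c r + e)) ->
  ((\sum_(r < n) `|c r.+1 - c r|)%:E <= total_variation (p 0%N) (p n.+1) h)%E.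
Proof.
move=> near_c; apply/lee_addgt0Pr => e e0.
(* each of the [n.+1] error terms is at most [2 * d] since |u| <= 1 *)
pose d := e / (2 * n.+1%:R).
have d0 : 0 < d by rewrite divr_gt0// mulr_gt0 ?ltr0n.
pose u r : R := if (0 < r <= n)%N then Num.sg (c r - c r.-1) else 0.
have u0 : u 0%N = 0 by [].
have un : u n.+1 = 0 by rewrite /u ltnn andbF.
have u1 r : `|u r| <= 1.
  by rewrite /u; case: ifP => _; rewrite ?normr0// normr_sg; case: (_ != _).
have [t tP] : {t : nat -> R & forall r, (r <= n)%N ->
    p r < t r < p r.+1 /\ (u r - u r.+1) * (c r - h (t r)) <= 2 * d}.
  apply: (@choice _ _ (fun r t => (r <= n)%N ->
    p r < t < p r.+1 /\ (u r - u r.+1) * (c r - h t) <= 2 * d)) => r.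
  have [rn|_] := leqP r n; last by exists 0.
  have [[t tr ht] [s sr hs]] := near_c r d rn d0.
  have := u1 r; have := u1 r.+1; rewrite !ler_norml => /andP[? ?] /andP[? ?].
  have [w0|w0] := leP 0 (u r - u r.+1).
    by exists t => _; split=> //; nra.
  by exists s => _; split=> //; nra.
rewrite (le_trans _ (leeD (le_variation_points h (fun r rn => (tP r rn).1)) (le_refl _)))//.
rewrite lee_fin.
have -> : \sum_(r < n) `|c r.+1 - c r| = \sum_(r < n.+1) u r.+1 * (c r.+1 - c r).
  rewrite big_ord_recr /= un mul0r addr0; apply: eq_bigr => r _.
  by rewrite /u ltn_ord /= normrEsg.
have -> : \sum_(r < n.+1) u r.+1 * (c r.+1 - c r) =
    \sum_(r < n.+1) u r.+1 * (h (t r.+1) - h (t r)) +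
    \sum_(r < n.+1) (u r - u r.+1) * (c r - h (t r)).
  have := sum_by_parts u (fun r => c r - h (t r)) n.+1.
  rewrite u0 un !mul0r subr0 addr0 => <-.
  by rewrite -big_split; apply: eq_bigr => r _ /=; ring.
apply: lerD.
  rewrite big_ord_recr /= un mul0r addr0; apply: ler_sum => r _.
  by rewrite (le_trans (ler_norm _))// normrM ler_piMl.
apply: (@le_trans _ _ (\sum_(r < n.+1) 2 * d)).
  by apply: ler_sum => r _; case: (tP r (leq_ord r)).
rewrite sumr_const card_ord -[leLHS]mulr_natr /d le_eqVlt; apply/orP; left.
by apply/eqP; field; rewrite addrC natr1 pnatr_eq0.
Qed.

End TotalVariation.

(** * The total variation of the derivative of a spline *)

Section SplineDerivative.
Variables (R : realType) (n k : nat).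
Hypothesis n0 : (0 < n)%N.
Notation knot := (grid R n).
Notation U := (off_inputs n knot).
Implicit Type a : 'I_n -> R.

Definition spline a (t : R) : R := \sum_j a j * hfun k knot j.+1 t.

(** The [k]-th derivative of [spline a] between the knots: basis functions of degree
    less than [k] disappear, and the others become [k!] times their
    indicator. *)
Definition step_deriv a (t : R) : R :=
  k`!%:R * \sum_j a j * ((k <= j)%N && ((j <= k)%N || (knot j < t)))%:R.

Definition level a (r : nat) : R :=
  k`!%:R * \sum_j a j * ((k <= j)%N && ((j <= k)%N || (j <= r)%N))%:R.

Lemma off_inputs01 : U `<=` `]0, 1[.
Proof. by move=> t [t01 _]; rewrite /= in_itv. Qed.

Lemma off_inputs_grid j : ~ U (knot j).
Proof.
case: j => [|j]; first by rewrite /grid mul0r => -[]; rewrite ltxx.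
move=> [/andP[_ j1] /(_ j.+1)]; rewrite eqxx; apply/not_implyP; split=> //.
by move: j1; rewrite ltr_pdivrMr ?ltr0n// mul1r ltr_nat => /ltnW.
Qed.

Lemma open_off_inputs : open U.
Proof.
have -> : U = `]0, 1[%classic `&` ~` (knot @` `I_n.+1).
  apply/seteqP; split => t.
    move=> tU; split; first exact: off_inputs01.
    by move=> [j _ jt]; apply: (@off_inputs_grid j); rewrite jt.
  move=> [/=]; rewrite in_itv /= => t01 tg; split=> // i /andP[_ i_n].
  by apply/eqP => ti; apply: tg; exists i.
apply: openI; first exact: itv_open.
apply: closed_openC.
apply: (iffLR accessible_finite_set_closed).
  exact/hausdorff_accessible/Rhausdorff.
exact/finite_image/finite_II.
Qed.

Lemma grid_lt_between r t j : knot r < t < knot r.+1 -> (knot j < t) = (j <= r)%N.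
Proof.
move=> /andP[rt tr]; have [jr|rj] := leqP j r.
  by apply: le_lt_trans rt; rewrite leNgt (grid_lt R n0) -leqNgt.
by apply/negbTE; rewrite -leNgt (le_trans (ltW tr))// leNgt (grid_lt R n0) -leqNgt.
Qed.

Lemma step_deriv_between a r t : knot r < t < knot r.+1 -> step_deriv a t = level a r.
Proof.
move=> rt; congr (_ * _); apply: eq_bigr => j _.
by rewrite (grid_lt_between _ rt).
Qed.

Lemma sub_off_inputs r u v : (r < n)%N -> knot r < u -> v < knot r.+1 ->
  `[u, v] `<=` U.
Proof.
move=> rn ru vr t /=; rewrite in_itv /= => /andP[ut tv].
have rt : knot r < t < knot r.+1 by rewrite (lt_le_trans ru ut) (le_lt_trans tv vr).
have /andP[h1 h2] := rt; split.
  rewrite (le_lt_trans _ h1) ?divr_ge0//= (lt_le_trans h2)//.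
  by rewrite ler_pdivrMr ?ltr0n// mul1r ler_nat.
move=> i _; apply/eqP => ti; move: h1 h2; rewrite ti !(grid_lt R n0).
by rewrite ltnS => /leq_trans h /h; rewrite ltnn.
Qed.

(** On [U] the untruncated powers may be truncated at 0, so that all basis functions
    are truncated polynomials. *)
Lemma is_weak_derivative_spline a : is_weak_derivative U k (spline a) (step_deriv a).
Proof.
pose s (j : 'I_n) := if (j <= k)%N then 0 : R else knot j.
have sE (j : 'I_n) t : t \in U -> ((j <= k)%N || (knot j < t)) = (s j < t).
  rewrite inE => -[/andP[t0 _] _]; rewrite /s; case: ifP => //=.
apply: (@is_weak_derivative_eq _ _ _
  (fun t => \sum_j a j * ((basis_poly k knot j).[t] * (s j < t)%R%:R)) _
  (fun t => \sum_j a j * (((basis_poly k knot j)^`(k)).[t] * (s j < t)%R%:R))).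
- by move=> t tU; apply: eq_bigr => j _; rewrite hfunE sE.
- move=> t tU; rewrite /step_deriv mulr_sumr; apply: eq_bigr => j _.
  by rewrite derivn_basis_poly sE// -mulnb natrM; ring.
apply: is_weak_derivative_sum; first exact: open_off_inputs.
move=> j; apply: is_weak_derivative_trunc.
- exact: open_off_inputs.
- exact: off_inputs01.
- rewrite /s; case: ifP => // _.
  by rewrite ltr_pdivrMr ?ltr0n// mul1r ltr_nat.
- rewrite /s; case: ifP => _; last exact: off_inputs_grid.
  by have := @off_inputs_grid 0; rewrite /grid mul0r.
Qed.

Lemma total_variation_step_deriv a :
  (total_variation 0 1 (step_deriv a) <= (k`!%:R * \sum_(j < n | (k < j)%N) `|a j|)%:E)%E.
Proof.
have -> : step_deriv a = fun t => k`!%:R * (\sum_j a j * (j == k :> nat)%:R) +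
    \sum_j (k`!%:R * (a j * (k < j)%N%:R)) * (knot j < t)%R%:R.
  apply/funext => t; rewrite /step_deriv !mulr_sumr -big_split; apply: eq_bigr => j _ /=.
  rewrite -!mulrA -mulrDr -mulrDr; congr (_ * (_ * _)).
  by case: ltngtP => _ /=; rewrite ?mul0r ?mul1r ?addr0 ?add0r.
rewrite (le_trans (total_variation_jumps _ _ _ ler01))// lee_fin.
rewrite mulr_sumr [leRHS]big_mkcond /=; apply: ler_sum => j _.
by case: ifP => _ /=; rewrite ?mulr1 ?mulr0 ?normr0// normrM normr_nat.
Qed.

Lemma sum_level_steps a :
  \sum_(r < n.-1) `|level a r.+1 - level a r| =
  k`!%:R * \sum_(j < n | (k < j)%N) `|a j|.
Proof.
pose b (i : nat) := \sum_j (a j * (k < j)%N%:R) * (j == i :> nat)%:R.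
have stepE r : level a r.+1 - level a r = k`!%:R * b r.+1.
  rewrite -mulrBr -sumrB; congr (_ * _); apply: eq_bigr => j _.
  rewrite -mulrBr -mulrA; congr (_ * _); rewrite (leq_eqVlt j r.+1) ltnS.
  case: (ltngtP k j) => kj /=; rewrite ?subrr ?mul0r ?mul1r//.
  by case: eqP => [->|_] /=; rewrite ?ltnn ?subr0 ?subrr.
have bE (j : 'I_n) : `|b j| = if (k < j)%N then `|a j| else 0.
  rewrite /b (sumr_delta (fun j => a j * (k < j)%N%:R) (ltn_ord j)) /=.
  rewrite [Ordinal _](_ : _ = j); last exact: val_inj.
  by case: ifP; rewrite /= ?mulr1 ?mulr0 ?normr0.
rewrite [in RHS]big_mkcond /=.
under [in RHS]eq_bigr do rewrite -bE.
rewrite -(big_mkord xpredT (fun j => `|b j|)) big_ltn// big_add1 big_mkord.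
rewrite (bE (Ordinal n0)) /= add0r mulr_sumr; apply: eq_bigr => r _.
by rewrite stepE normrM normr_nat.
Qed.

Lemma spline_step_deriv a : k = 0%N -> spline a = step_deriv a.
Proof.
move=> k0; apply/funext => t; rewrite /step_deriv mulr_sumr; apply: eq_bigr => j _.
have dE : (basis_poly k knot j)^`(k) = basis_poly k knot j by rewrite [X in _^`(X)]k0.
by rewrite hfunE -mulnb natrM -dE derivn_basis_poly; ring.
Qed.

(** For [k = 0] the only version is the spline, which takes the level on the whole
    interval; for [k > 0] a version is controlled only through its integrals,
    whence the margin [e]. *)
Lemma derivative_versions_near_level a g r e : derivative_versions U k (spline a) g ->
  (r < n)%N -> 0 < e ->
  (exists2 t, knot r < t < knot r.+1 & level a r - e <= g t) /\
  (exists2 t, knot r < t < knot r.+1 & g t <= level a r + e).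
Proof.
move=> gv rn e0.
have rr : knot r < knot r.+1 by rewrite (grid_lt R n0).
pose u := (2 * knot r + knot r.+1) / 3; pose v := (knot r + 2 * knot r.+1) / 3.
have ru : knot r < u by rewrite /u; lra.
have uv : u < v by rewrite /u /v; lra.
have vr : v < knot r.+1 by rewrite /v; lra.
have between t : u <= t <= v -> knot r < t < knot r.+1.
  by move=> /andP[ut tv]; rewrite (lt_le_trans ru ut) (le_lt_trans tv vr).
have stepE t : u <= t <= v -> step_deriv a t = level a r.
  by move=> /between; exact: step_deriv_between.
move: gv; case: (posnP k) => [k0|k_gt0] gv.
  have -> : g = step_deriv a by move: gv; rewrite -(spline_step_deriv a k0) k0.
  have uu : u <= u <= v by rewrite lexx ltW.
  by split; exists u; rewrite ?between// stepE//; lra.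
have {}gv : is_weak_derivative U k (spline a) g by case: k k_gt0 gv.
have wd := is_weak_derivative_spline a.
have uvU := sub_off_inputs rn ru vr.
have [t1 /between h1 g1] := weak_derivative_ge e0 uv uvU wd gv stepE.
have [t2 /between h2 g2] := weak_derivative_le e0 uv uvU wd gv stepE.
by split; [exists t1|exists t2].
Qed.

(** The step function is a version of the derivative and its variation is at most the
    sum of its jumps; every other version comes close to all the levels and has
    at least that variation. *)
Lemma TV_derivative_spline a :
  TV_derivative U k (spline a) =
  (k`!%:R * \sum_(j < n | (k < j)%N) `|a j|)%:E.
Proof.
apply/le_anti/andP; split.
  apply: le_trans (total_variation_step_deriv a); apply: ereal_inf_lbound.
  exists (step_deriv a) => //; case: (posnP k) => [k0|k_gt0].
    by rewrite -(spline_step_deriv a k0) k0.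
  by have := is_weak_derivative_spline a; case: k k_gt0.
apply: le_ereal_inf_tmp => _ [g gv <-].
have g0 : knot 0 = 0 by rewrite /grid mul0r.
have g1 : knot n.-1.+1 = 1 by rewrite prednK// /grid divff// pnatr_eq0 -lt0n.
rewrite -sum_level_steps -[X in total_variation X]g0 -[X in total_variation _ X]g1.
apply: total_variation_ge_steps => r e rn e0.
by apply: derivative_versions_near_level => //; rewrite -(prednK n0) ltnS.
Qed.

(** The penalties agree because the differences of the values are [k!/n^k] times the
    coefficients and the jumps of the derivative are [k!] times the
    coefficients. *)
Lemma spline_objE (y : 'cV[R]_n) lam a :
  spline_obj k knot y (lam / k`!%:R) (spline a) =
  (trend_obj k y lam (spline_mx R n k *m \col_j a j))%:E.
Proof.
rewrite /spline_obj TV_derivative_spline -EFinM -EFinD /trend_obj; congr (_%:E).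
congr (_ * _ + _).
  apply: eq_bigr => i _; rewrite !mxE; congr ((_ - _) ^+ 2).
  by apply: eq_bigr => j _; rewrite !mxE mulrC.
rewrite l1norm_diff_spline//; under [in RHS]eq_bigr do rewrite mxE.
have kf : k`!%:R != 0 :> R by rewrite pnatr_eq0 -lt0n fact_gt0.
have nk : n%:R != 0 :> R by rewrite pnatr_eq0 -lt0n.
by field; rewrite ?expf_neq0 ?kf ?nk.
Qed.

Lemma spline_grid a (i : 'I_n) :
  spline a (knot i.+1) = (spline_mx R n k *m \col_j a j) i 0.
Proof. by rewrite mxE; apply: eq_bigr => j _; rewrite !mxE mulrC. Qed.

End SplineDerivative.

(** * Equivalence of the two problems *)

(** Lets the even grid replace a sequence that agrees with it at the indices
    from 1 to [n] only. *)
Lemma eq_hfun (R : realType) k (x x' : nat -> R) n i t : (0 < i <= n)%N ->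
  (forall i, (1 <= i <= n)%N -> x i = x' i) -> hfun k x i t = hfun k x' i t.
Proof.
move=> /andP[i0 i_n] xx'; rewrite /hfun; case: ltnP => // ki.
rewrite xx'; last by lia.
by congr (_ * _); apply: eq_big_nat => l lk; rewrite xx'//; lia.
Qed.

Theorem lemma5 (R : realType) (k n : nat) (hn : (k.+2 <= n)%N)
    (y : 'cV[R]_n) (lam : R) (hlam : 0 <= lam)
    (x : nat -> R)
    (hx : forall i : nat, (1 <= i <= n)%N -> x i = i%:R / n%:R) :
  exists (fhat : R -> R) (bhat : 'cV[R]_n),
    [/\ argmin (Hspace n k x) (spline_obj k x y (lam / k`!%:R)) = [set fhat],
        argmin [set: 'cV[R]_n] (trend_obj k y lam) = [set bhat] &
        forall i : 'I_n, bhat i 0 = fhat (x i.+1)].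
Proof.
have n0 : (0 < n)%N by exact: leq_trans hn.
have HE : Hspace n k x = [set spline k a | a in [set: 'I_n -> R]].
  have hE (a : 'I_n -> R) : (fun t => \sum_j a j * hfun k x j.+1 t) = spline k a.
    apply/funext => t; apply: eq_bigr => j _; congr (_ * _).
    by apply: (eq_hfun (x' := grid R n) k t (i := j.+1) (n := n)); rewrite ?ltn_ord.
  apply/seteqP; split => [_ [a ->]|_ [a _ <-]]; first by exists a.
  by exists a.
have xE (i : 'I_n) : x i.+1 = grid R n i.+1 by rewrite hx// ltn_ord.
have offE : off_inputs n x = off_inputs n (grid R n).
  apply/seteqP; split => t [t01 tx]; split=> // i i_n;
  by have := tx i i_n; rewrite /grid hx.
have objE a : spline_obj k x y (lam / k`!%:R) (spline k a) =
    (trend_obj k y lam (spline_mx R n k *m \col_j a j))%:E.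
  rewrite -spline_objE// /spline_obj offE; congr ((_ * _)%:E + _)%E.
  by apply: eq_bigr => i _; rewrite xE.
have c0 : 0 <= n%:R ^+ k / k`!%:R * lam by rewrite mulr_ge0// divr_ge0// exprn_ge0.
have [b bmin] := penalized_ls_argmin (diff_mx R n k.+1) y c0.
pose c := invmx (spline_mx R n k) *m b; pose a j := c j 0.
have Hc : spline_mx R n k *m c = b by rewrite mulKVmx// spline_mx_unit.
have ac : \col_j a j = c by apply/colP => j; rewrite mxE.
have [_ bP] : argmin [set: 'cV[R]_n] (trend_obj k y lam) b by rewrite bmin.
exists (spline k a), b; split => //; last first.
  by move=> i; rewrite xE spline_grid ac Hc.
apply/seteqP; split => [f [+ fmin]|_ ->].
  rewrite HE => -[a' _ fE]; rewrite -fE; move: fmin; rewrite -fE => fmin.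
  have a'b : spline_mx R n k *m \col_j a' j = b.
    suff : argmin [set: 'cV[R]_n] (trend_obj k y lam) (spline_mx R n k *m \col_j a' j).
      by rewrite bmin.
    split=> // d _; apply: le_trans (bP d I).
    have := fmin (spline k a); rewrite HE !objE ac Hc lee_fin; apply.
    by exists a.
  congr (spline k _); apply/funext => j.
  have : \col_j a' j = c by rewrite /c -a'b mulKmx// spline_mx_unit.
  by move=> /(congr1 (fun v : 'cV_n => v j 0)); rewrite mxE.
split; first by rewrite HE; exists a.
by move=> f; rewrite HE => -[a' _ <-]; rewrite !objE lee_fin ac Hc; exact: bP.
Qed.
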